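(* Let $S(t)$ be a finite set of polynomial sites in general position at $t=0$. Let $l(0)=\{l_1(0),\dots,l_m(0)\}$ be the cluster locations of $S(t)$ at $t=0$, and write $S(t)=\bigcup_{j=1}^m S_j(t)$, where $S_j(t)$ is the set of sites $p(t)\in S(t)$ with $p(0)=l_j(0)$. Then the shape of the Voronoi diagram of $S(t)$ at $t=0$ is obtained by plugging the shapes of the Voronoi diagrams of the clusters into the Voronoi diagram of the cluster locations: $$\delta V(S(0)) \;=\; \delta V(l(0))\;\cup\;\bigcup_{j=1}^{m}\bigl(\,V(l_j(0))\,\cap\,\delta V(S_j(0))\,\bigr).$$ Here $V(l_j(0))$ is the ordinary Voronoi cell of $l_j(0)$ in the ordinary Voronoi diagram of the distinct points $l(0)$, and $\delta V(l(0))=\bigcup_j\partial V(l_j(0))$.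
   Context: A polynomial site is a pair $p(t)=(p(t)_x,p(t)_y)\in\mathbb{R}[t]^2$; the sites of $S(t)$ are pairwise distinct as elements of $\mathbb{R}[t]^2$. Three sites $u,v,w$ are collinear if the determinant with rows $(1,u_x,u_y),(1,v_x,v_y),(1,w_x,w_y)$ is the zero polynomial; four sites are cocircular if the $4\times 4$ determinant with rows $(q_x,q_y,q_x^2+q_y^2,1)$ is the zero polynomial. $S(t)$ is in general position at $t=0$ if no three sites are collinear and no four are cocircular. The cluster locations are the distinct points among the positions $p(0)$, $p\in S$. The direction $\phi_{uv}$ of distinct sites $u,v$ is given by $(\cos\phi_{uv},\sin\phi_{uv})=\lim_{t\downarrow0}\frac{v(t)-u(t)}{\|v(t)-u(t)\|}$. For a set of distinct polynomial sites $p_1,\dots,p_r$, the Voronoi half-plane at $t=0$ is $vh(p_i,p_j)=\{z\in\mathbb{R}^2:(\cos\phi_{p_ip_j},\sin\phi_{p_ip_j})\cdot(z-\tfrac12(p_i(0)+p_j(0)))\le0\}$, and the Voronoi cell at $t=0$ is $V(p_i(0))=\bigcap_{j\ne i}vh(p_i,p_j)$ (equal to $\mathbb{R}^2$ if $r=1$). The shape $\delta V$ of the Voronoi diagram at $t=0$ is the union of the topological boundaries of all Voronoi cells, $\delta V=\bigcup_i\partial V(p_i(0))$. $\delta V(S_j(0))$ is the shape for the set of sites $S_j(t)$ alone. *)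

(* Defs.v *)
From HB Require Import structures.
From mathcomp Require Import all_boot all_order all_algebra.
From mathcomp Require Import all_classical all_reals all_analysis.

Set Implicit Arguments.
Unset Strict Implicit.
Unset Printing Implicit Defensive.

Import Order.TTheory GRing.Theory Num.Theory.
Import numFieldNormedType.Exports.

Local Open Scope classical_set_scope.
Local Open Scope ring_scope.

Section PlaneAndSites.
Context {R : realType}.

(* The library norm on a product is the sup norm, so the Euclidean structure of
   the plane is introduced separately; the product topology is the usual one. *)
Definition plane_dot (a b : R * R) : R := a.1 * b.1 + a.2 * b.2.

Definition plane_norm (a : R * R) : R := Num.sqrt (a.1 ^+ 2 + a.2 ^+ 2).

Definition boundary (A : set (R * R)) : set (R * R) := closure A `\` A°.

Definition site : Type := ({poly R} * {poly R})%type.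

Definition site_at (p : site) (t : R) : R * R := (p.1.[t], p.2.[t]).

Definition collinear (u v w : site) : Prop :=
  \det (\matrix_(i < 3, j < 3)
    let q := [:: u; v; w]`_i in [:: 1; q.1; q.2]`_j) = 0.

Definition cocircular (u v w x : site) : Prop :=
  \det (\matrix_(i < 4, j < 4)
    let q := [:: u; v; w; x]`_i in
    [:: q.1; q.2; q.1 ^+ 2 + q.2 ^+ 2; 1]`_j) = 0.

Definition general_position (S : set site) : Prop :=
  (forall u v w, S u -> S v -> S w ->
     uniq [:: u; v; w] -> ~ collinear u v w) /\
  (forall u v w x, S u -> S v -> S w -> S x ->
     uniq [:: u; v; w; x] -> ~ cocircular u v w x).

Definition cluster_locations (S : set site) : set (R * R) :=
  [set site_at p 0 | p in S].

Definition cluster_sites (S : set site) (l : R * R) : set site :=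
  [set p | S p /\ site_at p 0 = l].

(* The unit vector (cos phi_uv, sin phi_uv). The limit exists whenever
   u and v are distinct, the only case in which it is used. *)
Definition direction (u v : site) : R * R :=
  lim ((plane_norm (site_at v t - site_at u t))^-1 *:
       (site_at v t - site_at u t) @[t --> (0 : R)^'+]).

Definition vor_halfplane (p q : site) : set (R * R) :=
  [set z | plane_dot (direction p q)
             (z - 2^-1 *: (site_at p 0 + site_at q 0)) <= 0].

(* Indexed by the site p itself, since distinct sites may share p(0). *)
Definition site_cell (S : set site) (p : site) : set (R * R) :=
  \bigcap_(q in S `\ p) vor_halfplane p q.

Definition site_shape (S : set site) : set (R * R) :=
  \bigcup_(p in S) boundary (site_cell S p).

Definition point_cell (L : set (R * R)) (l : R * R) : set (R * R) :=
  [set z | forall k, L k -> plane_norm (z - l) <= plane_norm (z - k)].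

Definition point_shape (L : set (R * R)) : set (R * R) :=
  \bigcup_(l in L) boundary (point_cell L l).

End PlaneAndSites.

Arguments site : clear implicits.

(* Main.v *)
(* Seen from a site p, the half-planes against sites outside its cluster are the
   perpendicular-bisector half-planes of the cluster locations, so the cell of p
   is the intersection of the closed cell V(l_j) with the closed cell of p within
   its own cluster. For closed A and B, the boundary of A n B is
   (bd A n B) u (A n bd B); summing over the sites of a cluster, the cells within
   the cluster cover the plane, so the first parts add up to bd V(l_j). *)

Require Import Defs.
From mathcomp Require Import all_boot all_order all_algebra.
From mathcomp Require Import all_classical all_reals all_analysis.
From mathcomp Require Import ring finmap.

Import Order.TTheory GRing.Theory Num.Theory.
Import numFieldNormedType.Exports.

Local Open Scope classical_set_scope.
Local Open Scope ring_scope.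

(** * Euclidean distances and topological boundaries in the plane *)

Section PlaneGeometry.
Context {R : realType}.
Implicit Types (a b z : R * R) (A B : set (R * R)).

Definition sqdist a b : R := (a.1 - b.1) ^+ 2 + (a.2 - b.2) ^+ 2.

Lemma plane_norm_le_sqdist a b z :
  (plane_norm (z - a) <= plane_norm (z - b)) = (sqdist z a <= sqdist z b).
Proof. by rewrite /plane_norm ler_sqrt// addr_ge0// sqr_ge0. Qed.

Lemma plane_norm_eq0 a : (plane_norm a == 0) = (a == 0).
Proof.
rewrite sqrtr_eq0 -[RHS]/((a.1 == 0) && (a.2 == 0)).
have h1 := sqr_ge0 a.1; have h2 := sqr_ge0 a.2.
(* [Num.sqrt] is 0 on negative numbers, so its vanishing only gives [<= 0]; nonnegativity of the sum
   of squares turns this into equality. *)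
by rewrite -[_ <= 0]andbT -(addr_ge0 h1 h2) -eq_le paddr_eq0// !sqrf_eq0.
Qed.

Lemma plane_dotZl (k : R) a b : plane_dot (k *: a) b = k * plane_dot a b.
Proof. by rewrite /plane_dot /= -!mulrA mulrDr. Qed.

(** The squared norms of [z] cancel. This turns the sign in a half-plane into a comparison of
    distances, both at time 0 and at positive times. *)
Lemma plane_dot_bisector a b z :
  plane_dot (b - a) (z - 2^-1 *: (a + b)) = (sqdist z a - sqdist z b) / 2.
Proof.
case: a b z => [a1 a2] [b1 b2] [z1 z2].
by rewrite /plane_dot /sqdist /=; change GRing.scale with (@GRing.mul R); field.
Qed.

Lemma cvg_plane_dot (T : Type) (F : set_system T) {FF : Filter F}
    (f g : T -> R * R) a b :
  f @ F --> a -> g @ F --> b -> plane_dot (f x) (g x) @[x --> F] --> plane_dot a b.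
Proof.
have c1 (h : T -> R * R) (c : R * R) : h @ F --> c -> (h x).1 @[x --> F] --> c.1.
  by move=> hc; apply: (cvg_comp _ _ hc); exact: cvg_fst.
have c2 (h : T -> R * R) (c : R * R) : h @ F --> c -> (h x).2 @[x --> F] --> c.2.
  by move=> hc; apply: (cvg_comp _ _ hc); exact: cvg_snd.
move=> fa gb.
by apply: cvgD; apply: cvgM; [exact: (c1 f)|exact: (c1 g)|exact: (c2 f)|exact: (c2 g)].
Qed.

Lemma cvg_plane_norm (T : Type) (F : set_system T) {FF : Filter F}
    (f : T -> R * R) a :
  f @ F --> a -> plane_norm (f x) @[x --> F] --> plane_norm a.
Proof.
move=> fa.
have dot_cvg : (f x).1 ^+ 2 + (f x).2 ^+ 2 @[x --> F] --> a.1 ^+ 2 + a.2 ^+ 2.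
  exact: (cvg_plane_dot _ _ _ _ _ _ fa fa).
by apply: (cvg_comp _ _ dot_cvg); exact: sqrt_continuous.
Qed.

Lemma boundary_setI A B : closed A -> closed B ->
  boundary (A `&` B) = (boundary A `&` B) `|` (A `&` boundary B).
Proof.
move=> cA cB; rewrite /boundary interiorI.
rewrite -!(closure_id _).1//; last exact: closedI.
apply/seteqP; split => x /=; last by tauto.
by move=> [[Ax Bx] nAB]; have [?|?] := pselect (A° x); [right|left]; tauto.
Qed.

End PlaneGeometry.

Section Sites.
Context {R : realType}.
Implicit Types (p q w : site R) (S : set (site R)) (z : R * R).

(** * Limits of sites and their directions *)

Lemma site_cvg p : site_at p t @[t --> (0 : R)^'+] --> site_at p 0.
Proof.
have horner_cvg (r : {poly R}) : r.[t] @[t --> (0 : R)^'+] --> r.[0].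
  by apply: cvg_at_right_filter; exact: continuous_horner.
exact: cvg_pair (horner_cvg p.1) (horner_cvg p.2).
Qed.

(* Cancelling the common power of t makes the direction a limit of continuous
   functions defined at 0. *)
Lemma site_factor w : w != 0 ->
  exists n (v : site R), site_at v 0 != 0 /\ w = ('X^n * v.1, 'X^n * v.2).
Proof.
case: w => w1 w2 w0.
have nz (v1 v2 : {poly R}) : ~~ root v1 0 \/ ~~ root v2 0 ->
    site_at (v1, v2) 0 != 0.
  by rewrite -[site_at _ _ == _]/(_ && _) negb_and; case=> ->; rewrite ?orbT.
have [m [v1 r1 e1]] := multiplicity_XsubC w1 0.
have [n [v2 r2 e2]] := multiplicity_XsubC w2 0.
rewrite subr0 mulrC in e1; rewrite subr0 mulrC in e2.
(* A zero coordinate has no finite order at 0, so the other one dictates the power. *)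
have [z1|n1] := eqVneq w1 0.
  have n2 : w2 != 0 by apply: contraNneq w0 => z2; rewrite z1 z2.
  exists n, (0, v2); split; first by apply: nz; right; exact: implyP r2 n2.
  by rewrite mulr0 z1 e2.
have [z2|n2] := eqVneq w2 0.
  exists m, (v1, 0); split; first by apply: nz; left; exact: implyP r1 n1.
  by rewrite mulr0 z2 e1.
have {}r1 := implyP r1 n1; have {}r2 := implyP r2 n2.
(* The smaller order is factored out; the coordinate attaining it stays nonzero at 0. *)
have [le|/ltnW le] := leqP m n.
  exists m, (v1, 'X^(n - m) * v2); split; first by apply: nz; left.
  by rewrite mulrA -exprD subnKC// e1 e2.
exists n, ('X^(m - n) * v1, v2); split; first by apply: nz; right.
by rewrite mulrA -exprD subnKC// e1 e2.
Qed.

Lemma normalize_cvg w : site_at w 0 != 0 ->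
  (plane_norm (site_at w t))^-1 *: site_at w t @[t --> (0 : R)^'+] -->
  (plane_norm (site_at w 0))^-1 *: site_at w 0.
Proof.
move=> w0; apply: cvgZ; last exact: site_cvg.
apply: cvgV; first by rewrite plane_norm_eq0.
by apply: cvg_plane_norm; exact: site_cvg.
Qed.

Lemma site_atB p q t : site_at q t - site_at p t = site_at (q - p) t.
Proof. by apply/esym/pair_equal_spec; rewrite /= !hornerE. Qed.

(** Certifies that the [lim] in [direction] is a genuine limit rather than a default value. *)
Lemma direction_cvg p q : p != q ->
  (plane_norm (site_at q t - site_at p t))^-1 *: (site_at q t - site_at p t)
    @[t --> (0 : R)^'+] --> direction p q.
Proof.
rewrite eq_sym -subr_eq0 => /site_factor[n [v [v0 e]]].
suff h : (plane_norm (site_at q t - site_at p t))^-1 *: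
    (site_at q t - site_at p t) @[t --> (0 : R)^'+] -->
    (plane_norm (site_at v 0))^-1 *: site_at v 0.
  by rewrite /direction (cvg_lim _ h)//; exact: norm_hausdorff.
apply: cvg_trans (normalize_cvg v v0); apply: near_eq_cvg; near=> t.
have t0 : 0 < t by near: t; exact: nbhs_right_gt.
have tn := exprn_gt0 n t0.
have vt : site_at (q - p) t = t ^+ n *: site_at v t.
  by rewrite e; apply/pair_equal_spec; rewrite /= !hornerE.
have normZ : plane_norm (t ^+ n *: site_at v t) = t ^+ n * plane_norm (site_at v t).
  rewrite /plane_norm /= !exprMn -mulrDr sqrtrM ?sqr_ge0//.
  by rewrite sqrtr_sqr gtr0_norm.
rewrite site_atB vt normZ scalerA; congr (_ *: _).
by rewrite invfM mulrAC mulVf ?mul1r// gt_eqF.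
Unshelve. all: by end_near. Qed.

(** The difference of the sites is nonzero at 0, so its normalization is continuous there and the
    direction is a positive multiple of the difference of the locations. *)
Lemma halfplane_apart p q : site_at p 0 != site_at q 0 ->
  vor_halfplane p q = [set z | sqdist z (site_at p 0) <= sqdist z (site_at q 0)].
Proof.
move=> pq.
have npq : site_at (q - p) 0 != 0 by rewrite -site_atB subr_eq0 eq_sym.
have dirE : direction p q =
    (plane_norm (site_at (q - p) 0))^-1 *: (site_at q 0 - site_at p 0).
  rewrite /direction; apply: (cvg_lim (@norm_hausdorff _ _)).
  rewrite site_atB; apply: cvg_trans (normalize_cvg _ npq).
  by apply: near_eq_cvg; near=> t; rewrite site_atB.
apply/funext => z; rewrite /vor_halfplane /= dirE plane_dotZl plane_dot_bisector pmulr_rle0.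
  by rewrite pmulr_lle0 ?invr_gt0// subr_le0.
by rewrite invr_gt0 lt_def plane_norm_eq0 npq sqrtr_ge0.
Unshelve. all: by end_near. Qed.

(** * Closed cells and their covering of the plane *)

Lemma closed_vor_halfplane p q : closed (vor_halfplane p q).
Proof.
rewrite (_ : vor_halfplane p q = (fun z => plane_dot (direction p q)
  (z - 2^-1 *: (site_at p 0 + site_at q 0))) @^-1` [set x | x <= 0])//.
apply: preimage_closed; last exact: closed_le.
move=> z _; apply: cvg_plane_dot; first exact: cvg_cst.
by apply: cvgB; [exact: cvg_id|exact: cvg_cst].
Qed.

Lemma closed_site_cell S p : closed (site_cell S p).
Proof. by apply: closed_bigI => q _; exact: closed_vor_halfplane. Qed.

Lemma closed_point_cell (L : set (R * R)) l : closed (point_cell L l).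
Proof.
have -> : point_cell L l =
    \bigcap_(k in L) [set z | plane_norm (z - l) - plane_norm (z - k) <= 0].
  by apply/seteqP; split => z h k /h /=; rewrite subr_le0.
apply: closed_bigI => k _.
apply: (@preimage_closed _ _
  (fun z => plane_norm (z - l) - plane_norm (z - k)) [set x | x <= 0]).
  move=> z _; apply: cvgB; apply: cvg_plane_norm; apply: cvgB;
    by [exact: cvg_id|exact: cvg_cst].
exact: closed_le.
Qed.

(** The product defining the half-plane is the limit of a nonnegative multiple of the difference of
    squared distances at time [t], and a positive limit forces positive values nearby. *)
Lemma eventually_closer p q z : p != q -> ~ vor_halfplane p q z ->
  \forall t \near (0 : R)^'+, sqdist z (site_at q t) < sqdist z (site_at p t).
Proof.
move=> pq /negP; rewrite -ltNge => gt0.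
have mid : z - 2^-1 *: (site_at p t + site_at q t) @[t --> (0 : R)^'+] -->
    z - 2^-1 *: (site_at p 0 + site_at q 0).
  apply: cvgB; first exact: cvg_cst.
  by apply: cvgZ; [exact: cvg_cst|apply: cvgD; exact: site_cvg].
have : \forall t \near (0 : R)^'+, 0 < plane_dot
    ((plane_norm (site_at q t - site_at p t))^-1 *: (site_at q t - site_at p t))
    (z - 2^-1 *: (site_at p t + site_at q t)).
  apply: (cvgr_gt (plane_dot (direction p q)
    (z - 2^-1 *: (site_at p 0 + site_at q 0)))) gt0.
  by apply: cvg_plane_dot mid; exact: direction_cvg.
apply: filterS => t; rewrite plane_dotZl plane_dot_bisector => h.
rewrite -subr_gt0 ltNge; apply/negP => le0; move: h.
rewrite ltNge; apply/negP; rewrite negbK mulr_ge0_le0 ?invr_ge0 ?sqrtr_ge0//.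
by rewrite mulr_le0_ge0.
Qed.

(* Otherwise every site would, at small positive times, be strictly farther
   from [z] than some other site, including the one nearest to [z]. *)
Lemma site_cells_cover S z : finite_set S -> S !=set0 ->
  exists2 p, S p & site_cell S p z.
Proof.
move=> finS [p0 Sp0]; apply: contrapT => nocell.
have closer p : S p -> exists2 q, S q &
    \forall t \near (0 : R)^'+, sqdist z (site_at q t) < sqdist z (site_at p t).
  move=> Sp; have : ~ site_cell S p z by move=> h; apply: nocell; exists p.
  move=> /existsNP[q /not_implyP[[Sq qp] nh]]; exists q => //.
  by apply: eventually_closer => //; apply/eqP => pq; exact: qp.
have Sfs p : p \in fset_set S <-> S p.
  by rewrite in_fset_set//; split; [exact: set_mem|exact: mem_set].
(* As [S] is finite, a single time serves all sites. *)
have [t allcloser] : exists t : R, forall p, S p -> exists2 q, S q &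
    sqdist z (site_at q t) < sqdist z (site_at p t).
  apply: (@filter_ex _ (0 : R)^'+).
  pose E p := [set t | exists2 q, S q &
    sqdist z (site_at q t) < sqdist z (site_at p t)].
  have : \forall t \near (0 : R)^'+, (\bigcap_(p in [set` fset_set S]) E p) t.
    apply: filter_bigI => p /Sfs/closer[q Sq].
    by apply: filterS => t h; exists q.
  by apply: filterS => t h p Sp; apply: h; exact/Sfs.
have fp0 := (Sfs p0).2 Sp0.
case: (arg_minP (fun p : fset_set S => sqdist z (site_at (val p) t))
  (isT : xpredT (FSetSub fp0))) => p _ pmin.
have [q Sq] : exists2 q, S q &
    sqdist z (site_at q t) < sqdist z (site_at (val p) t).
  by apply: allcloser; exact/Sfs/valP.
have fq := (Sfs q).2 Sq.
by rewrite ltNge (pmin (FSetSub fq)).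
Qed.

(** * Cells and boundaries through clusters *)

Lemma site_cell_cluster S p : S p ->
  site_cell S p = point_cell (cluster_locations S) (site_at p 0) `&`
                  site_cell (cluster_sites S (site_at p 0)) p.
Proof.
move=> Sp; apply/seteqP; split => z /=.
  move=> h; split; last by move=> q [[Sq _] qp]; apply: h.
  move=> _ [q Sq <-]; rewrite plane_norm_le_sqdist.
  have [<-//|pq] := eqVneq (site_at p 0) (site_at q 0).
  have : vor_halfplane p q z by apply: h; split=> // qp; rewrite qp eqxx in pq.
  by rewrite halfplane_apart.
move=> [hl hc] q [Sq qp].
have [pq|pq] := eqVneq (site_at p 0) (site_at q 0); first exact: hc.
by rewrite halfplane_apart//= -plane_norm_le_sqdist; apply: hl; exists q.
Qed.

Lemma boundary_site_cell S p : S p ->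
  boundary (site_cell S p) =
    (boundary (point_cell (cluster_locations S) (site_at p 0)) `&`
       site_cell (cluster_sites S (site_at p 0)) p) `|`
    (point_cell (cluster_locations S) (site_at p 0) `&`
       boundary (site_cell (cluster_sites S (site_at p 0)) p)).
Proof.
move=> Sp; rewrite site_cell_cluster//.
by apply: boundary_setI; [exact: closed_point_cell|exact: closed_site_cell].
Qed.

End Sites.

Theorem lemma4p41 (R : realType) (S : set (site R))
    (finS : finite_set S) (genS : general_position S) :
  site_shape S =
    point_shape (cluster_locations S) `|`
    \bigcup_(l in cluster_locations S)
      (point_cell (cluster_locations S) l `&` site_shape (cluster_sites S l)).
Proof.
apply/seteqP; split => z.
  move=> [p Sp]; rewrite boundary_site_cell// => -[[bz _]|[cz bz]].
    by left; exists (site_at p 0) => //; exists p.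
  by right; exists (site_at p 0); [exists p|split=> //; exists p].
move=> [[l [p0 Sp0 <-] bz]|[l _ [cz [p [Sp pl] bz]]]].
  (* The site [p0] only shows that the cluster is nonempty; the covering provides a possibly
     different [p] at the same location whose cluster cell contains [z]. *)
  have [||p [Sp pl] cz] := @site_cells_cover R (cluster_sites S (site_at p0 0)) z.
  - by apply: sub_finite_set finS => p [].
  - by exists p0.
  by exists p => //; rewrite boundary_site_cell// pl; left.
by exists p => //; rewrite boundary_site_cell// pl; right.
Qed.
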